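(* Let $G=\mathcal{AT}((k)_{k\ge 1})$ be the infinite antitree with generations $V_k$, $|V_k|=k$ for $k\in\mathbb{N}=\{1,2,3,\dots\}$. Consider either of the two vertex measures $\mu\equiv 1$ (non-normalized setting) or $\mu(x)=d_x$ (normalized setting). In each of these two settings, there exists a family of constants $K_x>0$, $x\in V$, with $K_x$ depending only on the generation of $x$, such that $G$ satisfies $CD(K_x,\infty,x)$ for all vertices $x$. Furthermore, for any such family, $$\liminf_{k\to\infty,\ x\in V_k} K_x=0 .$$
   Context: Antitree: for a sequence $(a_k)_{k\ge1}$ of positive integers, $\mathcal{AT}((a_k))$ is the simple graph whose vertex set is the disjoint union $V=\bigsqcup_{k\ge1}V_k$ of ''generations'' with $|V_k|=a_k$, where two distinct vertices $x\in V_k$, $y\in V_l$ are adjacent if and only if $|k-l|\le 1$ (so each generation induces a complete graph, consecutive generations are completely joined, and there are no other edges). $d_x$ denotes the vertex degree of $x$, and $x\sim y$ denotes adjacency. Bakry-Émery curvature: for a vertex measure $\mu:V\to(0,\infty)$ and functions $f,g:V\to\mathbb{R}$ put $$\Delta f(x)=\frac1{\mu(x)}\sum_{y\sim x}(f(y)-f(x)),$$ $$\Gamma(f,g)=\tfrac12\big(\Delta(fg)-f\Delta g-g\Delta f\big),\qquad \Gamma_2(f,g)=\tfrac12\big(\Delta\Gamma(f,g)-\Gamma(f,\Delta g)-\Gamma(g,\Delta f)\big),$$ and $\Gamma(f)=\Gamma(f,f)$, $\Gamma_2(f)=\Gamma_2(f,f)$. For $K\in\mathbb{R}$ and $x\in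 V$, the condition $CD(K,\infty,x)$ means $\Gamma_2(f)(x)\ge K\,\Gamma(f)(x)$ for all $f:V\to\mathbb{R}$. *)

(* Defs.v *)
From HB Require Import structures.
From mathcomp Require Import all_boot all_order all_algebra finmap.
From mathcomp Require Import all_classical all_reals all_analysis.

Set Implicit Arguments.
Unset Strict Implicit.
Unset Printing Implicit Defensive.

Import Order.TTheory GRing.Theory Num.Theory.

Local Open Scope classical_set_scope.
Local Open Scope ring_scope.

(* The value a 0 is never used: the tag i encodes the generation i.+1, so that
   generations are numbered from 1 as in (a_k)_{k >= 1}. *)
Definition antitree (a : nat -> nat) : choiceType := {i : nat & 'I_(a i.+1)}.

Definition gen (a : nat -> nat) (x : antitree a) : nat := (tag x).+1.

Definition at_adj (a : nat -> nat) : rel (antitree a) :=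
  fun x y => [&& x != y, (gen x <= (gen y).+1)%N & (gen y <= (gen x).+1)%N].

Arguments at_adj : clear implicits.

Definition nbrs (V : choiceType) (adj : rel V) (x : V) : set V :=
  [set y | adj x y].

(* [fset_set A] and [\sum_(y \in A)] have their intended meaning only when the
   set (resp. the support in it) is finite; [finite_at_nbrs] below guarantees
   this for antitrees. *)
Definition deg (V : choiceType) (adj : rel V) (x : V) : nat :=
  #|` fset_set (nbrs adj x)|%fset.

Section BakryEmery.
Variables (R : realType) (V : choiceType) (adj : rel V) (mu : V -> R).

Definition laplacian (f : V -> R) (x : V) : R :=
  (mu x)^-1 * \sum_(y \in nbrs adj x) (f y - f x).

Definition Gamma (f g : V -> R) (x : V) : R :=
  2^-1 * (laplacian (fun y => f y * g y) x
          - f x * laplacian g x - g x * laplacian f x).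

Definition Gamma2 (f g : V -> R) (x : V) : R :=
  2^-1 * (laplacian (Gamma f g) x
          - Gamma f (laplacian g) x - Gamma g (laplacian f) x).

Definition CD_infty (K : R) (x : V) : Prop :=
  forall f : V -> R, K * Gamma f f x <= Gamma2 f f x.

End BakryEmery.

Lemma finite_at_nbrs (a : nat -> nat) (x : antitree a) :
  finite_set (nbrs (at_adj a) x).
Proof.
pose s : seq (antitree a) :=
  flatten [seq [seq (Tagged (fun i => 'I_(a i.+1)) j : antitree a)
               | j <- enum 'I_(a i.+1)] | i <- iota 0 (tag x).+2].
apply: (sub_finite_set _ (finite_seq s)) => y /= /and3P[_ _ le_yx].
apply/flatten_mapP; exists (tag y); first by rewrite mem_iota.
by case: y {le_yx} => i j; apply: map_f; rewrite mem_enum.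
Qed.

(* Main.v *)
Require Import Defs.
From HB Require Import structures.
From mathcomp Require Import all_boot all_order all_algebra.
From mathcomp Require Import finmap all_classical all_reals all_analysis.
From mathcomp Require Import zify ring lra.
Import Order.TTheory GRing.Theory Num.Theory.
Local Open Scope classical_set_scope.
Local Open Scope ring_scope.

(** Fix a vertex x of generation k and put h = f - f(x).  On any locally finite
    graph, Gamma(f)(x) and Gamma_2(f)(x) are quadratic forms in h on the 2-ball
    around x ([Gamma_sq], [Gamma2_sq]), so that CD(K, oo, x) compares two
    quadratic forms ([CD_inftyP]).  On an antitree the neighbours of x form
    three complete layers (minus x), and the measure depends only on the
    generation; hence both forms depend on h only through the sums
    S_m = sum of h and P_m = sum of h^2 over the layers V_m with
    k-2 <= m <= k+2 ([curv_sum_layers]).  Up to positive factors, Gamma is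
    P_(k-1) + P_k + P_(k+1) and Gamma_2 is [curv_form].

    Positive curvature.  By Cauchy-Schwarz S_m^2 <= m P_m, and even
    S_k^2 <= (k-1) P_k because h(x) = 0.  The two outer layers are eliminated
    by completing a square ([outer_layer_bound]).  Writing each P_m as its
    least possible value S_m^2/n plus a variance (n = m, or n = k-1 for m = k),
    Gamma_2 becomes a positive combination of the three variances plus a
    ternary quadratic form in S_(k-1), S_k, S_(k+1).  In both settings its
    leading principal minors are quotients of polynomials in t = k-2 with
    positive coefficients, so it is positive definite and dominates a positive
    multiple of Gamma ([curv_form_coercive]).  The positivity is delicate: the
    determinant is of lower order in k than the product of the diagonal
    entries, so the minors are computed exactly.  The root k = 1, which has no
    layer below it, is treated in [curv_form_coercive_root].

    Decay.  For the test function h(y) = (generation of y) - k one finds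
    4 mu(x) Gamma_2 <= 4 in both settings, whereas 2 mu(x) Gamma = 2k; hence
    K <= 1/k for k >= 2 ([CD_le_inv_generation]), and every admissible family
    tends to 0. *)

Set Implicit Arguments.
Unset Strict Implicit.
Unset Printing Implicit Defensive.

(** * Positive definite ternary forms *)

(** Complete the square twice, in x and then in y; what is left of the third
    variable has the determinant as coefficient. *)
Lemma last_coordinate_bound (R : realFieldType) (p q r u v w : R) :
  0 < p -> 0 < p * q - u ^+ 2 ->
  forall x y z : R,
  (p * q * r + 2 * (u * v * w) - p * w ^+ 2 - q * v ^+ 2 - r * u ^+ 2) * z ^+ 2
  <= (p * q - u ^+ 2) * (p * x ^+ 2 + q * y ^+ 2 + r * z ^+ 2
       + 2 * u * (x * y) + 2 * v * (x * z) + 2 * w * (y * z)).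
Proof.
move=> p0; set d := p * q - u ^+ 2 => d0 x y z.
rewrite -subr_ge0 -(pmulr_rge0 _ p0).
rewrite [X in 0 <= X](_ : _ = d * (p * x + u * y + v * z) ^+ 2
   + (d * y + (p * w - u * v) * z) ^+ 2); last by rewrite /d; ring.
apply: addr_ge0; last exact: sqr_ge0.
by apply: mulr_ge0; [exact: ltW | exact: sqr_ge0].
Qed.

(** A quantitative form of Sylvester's criterion: the constant is the
    determinant over the trace of the adjugate, which bounds the least
    eigenvalue from below. *)
Lemma posdef3_coercive (R : realFieldType) (p q r u v w : R) :
  0 < p -> 0 < p * q - u ^+ 2 ->
  0 < p * q * r + 2 * (u * v * w) - p * w ^+ 2 - q * v ^+ 2 - r * u ^+ 2 ->
  exists2 e : R, 0 < e & forall x y z : R,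
    e * (x ^+ 2 + y ^+ 2 + z ^+ 2)
    <= p * x ^+ 2 + q * y ^+ 2 + r * z ^+ 2
       + 2 * u * (x * y) + 2 * v * (x * z) + 2 * w * (y * z).
Proof.
set d := p * q - _; set D := (X in _ -> _ -> 0 < X -> _) => p0 d0 D0.
have q0 : 0 < q.
  by rewrite -(pmulr_rgt0 _ p0) (lt_le_trans d0) // gerBl sqr_ge0.
set d2 := p * r - v ^+ 2; set d1 := q * r - w ^+ 2.
have d20 : 0 < d2.
  rewrite -(pmulr_rgt0 _ d0) (_ : _ * _ = (p * w - u * v) ^+ 2 + p * D).
    by rewrite ltr_wpDl ?sqr_ge0 ?mulr_gt0.
  by rewrite /d /d2 /D; ring.
have d10 : 0 < d1.
  rewrite -(pmulr_rgt0 _ d0) (_ : _ * _ = (q * v - u * w) ^+ 2 + q * D).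
    by rewrite ltr_wpDl ?sqr_ge0 ?mulr_gt0.
  by rewrite /d /d1 /D; ring.
have s0 : 0 < d + d2 + d1 by rewrite (addr_gt0 (addr_gt0 d0 d20) d10).
exists (D / (d + d2 + d1)); first by rewrite divr_gt0.
move=> x y z; rewrite mulrAC ler_pdivrMr //.
have zb := last_coordinate_bound r v w p0 d0 x y z.
have yb := last_coordinate_bound q u w p0 d20 x z y.
have xb := last_coordinate_bound p u v q0 d10 y z x.
by rewrite -/d -/d1 -/d2 in xb yb zb; rewrite /D; clearbody d d1 d2; lra.
Qed.

(** * The curvature form in the layer sums *)

Section Forms.
Variable R : realFieldType.
Implicit Types t w P S : R.

(** For a vertex of generation k, P0, ..., P4 and S0, ..., S4 are the layer sums
    of h^2 and of h over the generations k-2, ..., k+2, and w1, w2, w3 are the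
    values of 1/mu on the generations k-1, k, k+1; the form is then
    4 mu Gamma_2, see [curv_sum_layers]. *)
Definition curv_form k w1 w2 w3 P0 P1 P2 P3 P4 S0 S1 S2 S3 S4 : R :=
  w1 * ((k - 1) * (P0 + P1 + P2) - 4 * S1 * (S0 + S1 + S2) + 9 * (k - 1) * P1)
  + w2 * (k * (P1 + P2 + P3) - 4 * S2 * (S1 + S2 + S3) + 9 * k * P2)
  + w3 * ((k + 1) * (P2 + P3 + P4) - 4 * S3 * (S2 + S3 + S4)
          + 9 * (k + 1) * P3)
  - 3 * k * w2 * (P1 + P2 + P3) + 2 * w2 * (S1 + S2 + S3) ^+ 2.

(** The constraints are the Cauchy-Schwarz inequalities on the five layers around
    generation k = t + 2; the middle layer counts for k - 1 vertices only, since
    h vanishes at the base vertex. *)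
Definition coercive_curv_form t w1 w2 w3 : Prop :=
  exists2 e : R, 0 < e & forall P0 P1 P2 P3 P4 S0 S1 S2 S3 S4,
    0 <= P0 -> 0 <= P4 ->
    S0 ^+ 2 <= t * P0 -> S1 ^+ 2 <= (t + 1) * P1 -> S2 ^+ 2 <= (t + 1) * P2 ->
    S3 ^+ 2 <= (t + 3) * P3 -> S4 ^+ 2 <= (t + 4) * P4 ->
    e * (P1 + P2 + P3)
    <= curv_form (t + 2) w1 w2 w3 P0 P1 P2 P3 P4 S0 S1 S2 S3 S4.

(** Given its sum S over an outer layer of size n, h has the least P when it is
    constant on that layer; then minimize over S. *)
Lemma outer_layer_bound m n P S T : 0 < m -> 0 <= n -> 0 <= P ->
  S ^+ 2 <= n * P -> - (4 * n / m) * T ^+ 2 <= m * P - 4 * T * S.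
Proof.
move=> m0; rewrite le_eqVlt => /orP[/eqP <- P0|n0 P0 hS].
  rewrite mul0r => hS; have : S ^+ 2 == 0 by rewrite eq_le hS sqr_ge0.
  rewrite sqrf_eq0 => /eqP ->.
  by rewrite !mulr0 !mul0r oppr0 mul0r addr0 mulr_ge0 // ltW.
rewrite -subr_ge0 -(pmulr_rge0 _ (mulr_gt0 n0 m0)).
rewrite [X in 0 <= X](_ : _ = (m * S - 2 * n * T) ^+ 2
                          + m ^+ 2 * (n * P - S ^+ 2)).
  by rewrite addr_ge0 ?sqr_ge0 // mulr_ge0 ?sqr_ge0 // subr_ge0.
by field; rewrite gt_eqF.
Qed.

(** The numbers u1, u2, u3 are the coefficients of the three variances
    P_i - S_i^2/n_i in [curv_form], with n_i = k-1, k-1, k+1, and p, q, r, u, v,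
    w are the entries of the matrix of the remaining form in the variables S1,
    S3, S2.  This order of the variables keeps the second leading minor
    simple. *)
Lemma curv_form_coercive t w1 w2 w3 :
  0 <= t -> 0 < w1 -> 0 < w2 -> 0 < w3 ->
  let u1 := 10 * (t + 1) * w1 - 2 * (t + 2) * w2 in
  let u2 := (t + 1) * w1 + 7 * (t + 2) * w2 + (t + 3) * w3 in
  let u3 := 10 * (t + 3) * w3 - 2 * (t + 2) * w2 in
  let p := u1 / (t + 1) - 4 * w1 * (1 + t / (t + 1)) + 2 * w2 in
  let q := u3 / (t + 3) - 4 * w3 * (1 + (t + 4) / (t + 3)) + 2 * w2 in
  let r := u2 / (t + 1) - 2 * w2 in
  let u := 2 * w2 in let v := - (2 * w1) in let w := - (2 * w3) in
  0 < u1 -> 0 < u3 -> 0 < p -> 0 < p * q - u ^+ 2 ->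
  0 < p * q * r + 2 * (u * v * w) - p * w ^+ 2 - q * v ^+ 2 - r * u ^+ 2 ->
  coercive_curv_form t w1 w2 w3.
Proof.
move=> t0 w10 w20 w30 u1 u2 u3 p q r u v w u10 u30 p0 d0 D0.
have t1 : 0 < t + 1 by lra.
have t3 : 0 < t + 3 by lra.
have u20 : 0 < u2.
  by rewrite /u2 !addr_gt0 ?mulr_gt0 //; lra.
have [e1 e10 coer] := posdef3_coercive p0 d0 D0.
pose e := Num.min e1 (Num.min u1 (Num.min u2 u3)).
have e0 : 0 < e by rewrite !lt_min e10 u10 u20 u30.
have ee1 : e <= e1 by rewrite ge_min lexx.
have eu1 : e <= u1 by rewrite /e !ge_min lexx !orbT.
have eu2 : e <= u2 by rewrite /e !ge_min lexx !orbT.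
have eu3 : e <= u3 by rewrite /e !ge_min lexx !orbT.
exists e => // P0 P1 P2 P3 P4 S0 S1 S2 S3 S4 P00 P40 h0 h1 h2 h3 h4.
have b0 := outer_layer_bound S1 t1 t0 P00 h0.
have b4 : - (4 * (t + 4) / (t + 3)) * S3 ^+ 2 <= (t + 3) * P4 - 4 * S3 * S4.
  by apply: outer_layer_bound => //; lra.
(* A variance and the square of the corresponding sum control P. *)
have var (n P S c : R) : 1 <= n -> S ^+ 2 <= n * P -> e <= c ->
    e * P <= c * (P - S ^+ 2 / n) + e1 * S ^+ 2.
  move=> n1 hS ec; have n0 : 0 < n by lra.
  have V0 : 0 <= P - S ^+ 2 / n by rewrite subr_ge0 ler_pdivrMr // mulrC.
  have Sn : S ^+ 2 / n <= S ^+ 2.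
    by rewrite ler_pdivrMr // ler_peMr ?sqr_ge0.
  have E1 := ler_wpM2r V0 ec.
  have E2 := ler_wpM2l (ltW e0) Sn.
  have E3 := ler_wpM2r (sqr_ge0 S) ee1.
  lra.
have t11 : 1 <= t + 1 by lra.
have t13 : 1 <= t + 3 by lra.
have v1 := var _ _ _ _ t11 h1 eu1.
have v2 := var _ _ _ _ t11 h2 eu2.
have v3 := var _ _ _ _ t13 h3 eu3.
have cm := coer S1 S3 S2.
have c0 := ler_wpM2l (ltW w10) b0.
have c4 := ler_wpM2l (ltW w30) b4.
rewrite -subr_ge0.
(* Variances, ternary form, and the two outer layers: each bracket is >= 0. *)
rewrite [X in 0 <= X](_ : _ =
   (u1 * (P1 - S1 ^+ 2 / (t + 1)) + e1 * S1 ^+ 2 - e * P1)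
 + (u2 * (P2 - S2 ^+ 2 / (t + 1)) + e1 * S2 ^+ 2 - e * P2)
 + (u3 * (P3 - S3 ^+ 2 / (t + 3)) + e1 * S3 ^+ 2 - e * P3)
 + (p * S1 ^+ 2 + q * S3 ^+ 2 + r * S2 ^+ 2 + 2 * u * (S1 * S3)
    + 2 * v * (S1 * S2) + 2 * w * (S3 * S2)
    - e1 * (S1 ^+ 2 + S3 ^+ 2 + S2 ^+ 2))
 + (w1 * ((t + 1) * P0 - 4 * S1 * S0)
    - w1 * (- (4 * t / (t + 1)) * S1 ^+ 2))
 + (w3 * ((t + 3) * P4 - 4 * S3 * S4)
    - w3 * (- (4 * (t + 4) / (t + 3)) * S3 ^+ 2))).
  do 5!(apply: addr_ge0; last by rewrite subr_ge0).
  by rewrite subr_ge0.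
rewrite /p /q /r /u1 /u2 /u3 /u /v /w /curv_form; clearbody e.
by field; rewrite !gt_eqF.
Qed.

Lemma curv_form_coercive_const t : 0 <= t -> coercive_curv_form t 1 1 1.
Proof.
move=> t0.
have t1 : 0 < t + 1 by lra.
have t3 : 0 < t + 3 by lra.
have tn n : 0 <= t ^+ n by rewrite exprn_ge0.
apply: curv_form_coercive => //; try lra.
- rewrite [X in 0 < X](_ : _ = 2 * (t + 2) / (t + 1)); last first.
    by field; rewrite !gt_eqF.
  by rewrite divr_gt0 //; lra.
- rewrite [X in 0 < X](_ : _ = 4 / ((t + 1) * (t + 3))); last first.
    by field; rewrite !gt_eqF.
  by rewrite divr_gt0 ?mulr_gt0.
- rewrite [X in 0 < X](_ : _ = 12 * (t + 4) / ((t + 1) ^+ 2 * (t + 3))).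
    by rewrite divr_gt0 ?mulr_gt0 ?exprn_gt0 //; lra.
  by field; rewrite !gt_eqF.
Qed.

(** A vertex of generation m has degree 3m - 1, which is 3t + 2, 3t + 5, 3t + 8
    for m = t+1, t+2, t+3. *)
Lemma curv_form_coercive_deg t : 0 <= t ->
  coercive_curv_form t (3 * t + 2)^-1 (3 * t + 5)^-1 (3 * t + 8)^-1.
Proof.
move=> t0.
have t1 : 0 < t + 1 by lra.
have t3 : 0 < t + 3 by lra.
have d1 : 0 < 3 * t + 2 by lra.
have d2 : 0 < 3 * t + 5 by lra.
have d3 : 0 < 3 * t + 8 by lra.
have tn n : 0 <= t ^+ n by rewrite exprn_ge0.
apply: curv_form_coercive; rewrite ?invr_gt0 //.
- rewrite [X in 0 < X](_ : _ = (42 + 64 * t + 24 * t ^+ 2)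
                               / ((3 * t + 2) * (3 * t + 5))); last first.
    by field; rewrite !gt_eqF.
  by rewrite divr_gt0 ?mulr_gt0 //; have := tn 2; lra.
- rewrite [X in 0 < X](_ : _ = (118 + 112 * t + 24 * t ^+ 2)
                               / ((3 * t + 8) * (3 * t + 5))); last first.
    by field; rewrite !gt_eqF.
  by rewrite divr_gt0 ?mulr_gt0 //; have := tn 2; lra.
- rewrite [X in 0 < X](_ : _ = (26 + 22 * t + 6 * t ^+ 2)
     / ((t + 1) * (3 * t + 2) * (3 * t + 5))); last first.
    by field; rewrite !gt_eqF.
  by rewrite divr_gt0 ?mulr_gt0 //; move: (tn 2); lra.
- rewrite [X in 0 < X](_ : _ = 4 * (6 * t + 11) ^+ 2
     / ((t + 1) * (t + 3) * (3 * t + 2) * (3 * t + 5) ^+ 2 * (3 * t + 8)));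
    last by field; rewrite !gt_eqF.
  by rewrite divr_gt0 ?mulr_gt0 ?exprn_gt0 //; lra.
(* The determinant; products keep the numerals of its coefficients small. *)
- rewrite [X in 0 < X](_ : _ =
    12 * (540 * t ^+ 5 + 54 * 98 * t ^+ 4 + 27 * 739 * t ^+ 3
          + 22 * 1627 * t ^+ 2 + 44 * 683 * t + 2 * 4567)
    / ((t + 1) ^+ 2 * (t + 3) * (3 * t + 2) ^+ 2 * (3 * t + 5) ^+ 3
       * (3 * t + 8) ^+ 2)); last by field; rewrite !gt_eqF.
  apply: divr_gt0; last by rewrite !(mulr_gt0, exprn_gt0).
  by move: (tn 2) (tn 3) (tn 4) (tn 5); lra.
Qed.

(** At the root there is no generation k-1 = 0, and S2 = 0 because the layer of
    the root has no other vertex.  The condition w1 <= 5 w2 makes the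
    coefficient 2 w1 - 10 w2 of S3^2 nonpositive, so that the upper bound on
    S3^2 can be used. *)
Lemma curv_form_coercive_root w0 w1 w2 P2 P3 P4 S3 S4 :
  0 < w1 -> w1 <= 5 * w2 -> 0 <= P2 -> 0 <= P4 ->
  S3 ^+ 2 <= 2 * P3 -> S4 ^+ 2 <= 3 * P4 ->
  2 * w1 * (P2 + P3) <= curv_form 1 w0 w1 w2 0 0 P2 P3 P4 0 0 0 S3 S4.
Proof.
move=> w10 w12 P20 P40 h3 h4; have w20 : 0 < w2 by lra.
have b4 : - (4 * 3 / 2) * S3 ^+ 2 <= 2 * P4 - 4 * S3 * S4.
  exact: outer_layer_bound.
have c4 := ler_wpM2l (ltW w20) b4.
have w3 : 0 <= 10 * w2 - 2 * w1 by lra.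
have c3 := ler_wpM2l w3 h3.
have c2 : 0 <= (5 * w1 + 2 * w2) * P2 by rewrite mulr_ge0 //; lra.
by rewrite /curv_form; lra.
Qed.

(** The value of [curv_form] for h(y) = (generation of y) - k, where
    k = t + 2. *)
Definition generation_form t w1 w2 w3 : R :=
  let P m := (m - (t + 2)) ^+ 2 * m in let S m := (m - (t + 2)) * m in
  curv_form (t + 2) w1 w2 w3
    (P t) (P (t + 1)) (P (t + 2)) (P (t + 3)) (P (t + 4))
    (S t) (S (t + 1)) (S (t + 2)) (S (t + 3)) (S (t + 4)).

Lemma generation_form_const t : generation_form t 1 1 1 = 4.
Proof. by rewrite /generation_form /curv_form; ring. Qed.

Lemma generation_form_deg t : 0 <= t ->
  generation_form t (3 * t + 2)^-1 (3 * t + 5)^-1 (3 * t + 8)^-1 <= 4.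
Proof.
move=> t0.
have d1 : 0 < 3 * t + 2 by lra.
have d2 : 0 < 3 * t + 5 by lra.
have d3 : 0 < 3 * t + 8 by lra.
rewrite [X in X <= _](_ : _ = 4 * (18 * t ^+ 2 + 66 * t + 43)
          / ((3 * t + 2) * (3 * t + 5) * (3 * t + 8))); last first.
  by rewrite /generation_form /curv_form; field; rewrite !gt_eqF.
rewrite ler_pdivrMr ?mulr_gt0 //.
by have := (exprn_ge0 2 t0); have := (exprn_ge0 3 t0); lra.
Qed.

End Forms.

(** * Bakry-Emery forms on locally finite graphs *)

Section LocallyFinite.
Variables (R : realType) (V : choiceType) (adj : rel V) (mu : V -> R).
Hypothesis fin : forall x, finite_set (nbrs adj x).

Definition nbr_sum (g : V -> R) (x : V) : R := \sum_(y \in nbrs adj x) g y.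

Lemma nbr_sumE g x : nbr_sum g x = \sum_(y <- fset_set (nbrs adj x)) g y.
Proof. exact: fsbig_finite. Qed.

Lemma degE x : (deg adj x)%:R = nbr_sum (fun=> 1) x.
Proof. by rewrite nbr_sumE big_const_seq count_predT iter_addr_0. Qed.

Lemma laplacianE f x : laplacian adj mu f x
  = (mu x)^-1 * nbr_sum (fun y => f y - f x) x.
Proof. by []. Qed.

Lemma nbr_sumZ c g x : nbr_sum (fun y => c * g y) x = c * nbr_sum g x.
Proof. by rewrite !nbr_sumE mulr_sumr. Qed.

Lemma nbr_sumD g g' x :
  nbr_sum (fun y => g y + g' y) x = nbr_sum g x + nbr_sum g' x.
Proof. by rewrite !nbr_sumE big_split. Qed.

Lemma eq_nbr_sum g g' x : g =1 g' -> nbr_sum g x = nbr_sum g' x.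
Proof. by move=> /funext ->. Qed.

Lemma GammaE f g x : Gamma adj mu f g x
  = (2 * mu x)^-1 * nbr_sum (fun y => (f y - f x) * (g y - g x)) x.
Proof.
rewrite /Gamma !laplacianE invfM -mulrA; congr (_ * _).
rewrite mulrCA [g x * _]mulrCA -!mulrBr; congr (_ * _).
rewrite -!nbr_sumZ !nbr_sumE -!sumrB; apply: eq_bigr => y _; ring.
Qed.

(** This is 4 mu(x) Gamma_2(h)(x) when h(x) = 0.  The inner summand is
    (h(z) - 2 h(y))^2 - h(y)^2, the usual expression over paths x ~ y ~ z. *)
Definition curv_sum (h : V -> R) (x : V) : R :=
  nbr_sum (fun y => (mu y)^-1 *
    nbr_sum (fun z => h z ^+ 2 - 4 * h y * h z + 3 * h y ^+ 2) y) x
  - (mu x)^-1 * nbr_sum (fun=> 1) x * nbr_sum (fun y => h y ^+ 2) x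
  + 2 * (mu x)^-1 * nbr_sum h x ^+ 2.

Lemma Gamma_sq f x (h := fun y => f y - f x) : Gamma adj mu f f x
  = (2 * mu x)^-1 * nbr_sum (fun y => h y ^+ 2) x.
Proof. by rewrite GammaE; congr (_ * _); apply: eq_nbr_sum => y; ring. Qed.

Lemma Gamma2_sq f x (h := fun y => f y - f x) :
  Gamma2 adj mu f f x = (4 * mu x)^-1 * curv_sum h x.
Proof.
(* Opaque abbreviations, so that only the outer sums are matched below. *)
have [L LE] : {L | L = fun y => nbr_sum (fun z => f z - f y) y} by eexists.
have [Q QE] : {Q | Q = fun y => nbr_sum (fun z => (f z - f y) ^+ 2) y}.
  by eexists.
have inner y : nbr_sum (fun z => h z ^+ 2 - 4 * h y * h z + 3 * h y ^+ 2) y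
             = Q y - 2 * h y * L y.
  rewrite QE LE -mulNr -nbr_sumZ -nbr_sumD.
  by apply: eq_nbr_sum => z; rewrite /h; ring.
have GG y : Gamma adj mu f f y = 2^-1 * ((mu y)^-1 * Q y).
  by rewrite Gamma_sq invfM mulrA QE.
rewrite /Gamma2 GammaE laplacianE.
have -> : nbr_sum (fun y => Gamma adj mu f f y - Gamma adj mu f f x) x
        = 2^-1 * nbr_sum (fun y => (mu y)^-1 * Q y) x
          - 2^-1 * ((mu x)^-1 * Q x) * nbr_sum (fun=> 1) x.
  rewrite -[in RHS]mulNr -!nbr_sumZ -nbr_sumD.
  by apply: eq_nbr_sum => y; rewrite !GG; ring.
have -> : nbr_sum (fun y => (f y - f x) * (laplacian adj mu f y
                                           - laplacian adj mu f x)) x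
        = nbr_sum (fun y => (mu y)^-1 * (h y * L y)) x
          - (mu x)^-1 * L x * nbr_sum h x.
  rewrite -[in RHS]mulNr -!nbr_sumZ -nbr_sumD.
  by apply: eq_nbr_sum => y; rewrite !laplacianE LE /h; ring.
rewrite /curv_sum (eq_nbr_sum _ (fun y => congr1 _ (inner y))).
have -> : nbr_sum (fun y => (mu y)^-1 * (Q y - 2 * h y * L y)) x
        = nbr_sum (fun y => (mu y)^-1 * Q y) x
          - 2 * nbr_sum (fun y => (mu y)^-1 * (h y * L y)) x.
  rewrite -[in RHS]mulNr -!nbr_sumZ -nbr_sumD.
  by apply: eq_nbr_sum => y; ring.
have -> : L x = nbr_sum h x by rewrite LE.
have -> : Q x = nbr_sum (fun y => h y ^+ 2) x by rewrite QE.
rewrite !invfM.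
by set m := (mu x)^-1; field.
Qed.

Hypothesis mu_gt0 : forall x, 0 < mu x.

(** Both sides of the curvature inequality are unchanged when a constant is
    added to f, so functions vanishing at x suffice. *)
Lemma CD_inftyP K x : CD_infty adj mu K x <->
  forall h : V -> R, h x = 0 ->
    2 * K * nbr_sum (fun y => h y ^+ 2) x <= curv_sum h x.
Proof.
have m0 := mu_gt0 x.
have scale a b : (K * ((2 * mu x)^-1 * a) <= (4 * mu x)^-1 * b)
               = (2 * K * a <= b).
  rewrite -(ler_pM2l (_ : 0 < 4 * mu x)) ?mulr_gt0 //.
  by congr (_ <= _); field; rewrite gt_eqF.
split=> [cd h hx|H f].
  have := cd h; rewrite Gamma_sq Gamma2_sq scale.
  have -> : (fun y => h y - h x) = h by apply: funext => y; rewrite hx subr0.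
  by under eq_nbr_sum do rewrite hx subr0.
by rewrite Gamma_sq Gamma2_sq scale; apply: H; rewrite subrr.
Qed.

End LocallyFinite.

(** * Layers of the antitree *)

Section Layers.
Variable R : realType.
Notation V := (antitree id).
Notation adj := (at_adj id).
Implicit Types (g h : V -> R) (x y : V) (m n k : nat).

(** The vertices of generation m, as a list; generation 0 is empty, so that the
    root needs no separate treatment in sums over neighbours. *)
Definition layer m : seq V :=
  if m is n.+1 then [seq Tagged (fun i => 'I_i.+1) j | j <- enum 'I_n.+1]
  else [::].

Arguments layer : simpl never.

Lemma size_layer m : size (layer m) = m.
Proof. by case: m => // n; rewrite size_map size_enum_ord. Qed.

Lemma mem_layer m y : (y \in layer m) = (gen y == m).
Proof.
case: m => // n; apply/mapP/eqP => [[j _ ->]//|].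
case: y => i j; rewrite /gen /= => -[ein]; subst i.
by exists j; rewrite ?mem_enum.
Qed.

Lemma layer_uniq m : uniq (layer m).
Proof.
case: m => // n; rewrite map_inj_uniq ?enum_uniq // => i j /eqP.
by rewrite eq_Tagged => /eqP.
Qed.

Definition layer_sum g m : R := \sum_(y <- layer m) g y.

Lemma nbr_sum_layers g x : nbr_sum adj g x
  = layer_sum g (gen x).-1 + layer_sum g (gen x) + layer_sum g (gen x).+1 - g x.
Proof.
have fin := @finite_at_nbrs id x.
rewrite nbr_sumE; last exact: finite_at_nbrs.
suff /(perm_big _) E : perm_eq
    ((layer (gen x).-1 ++ layer (gen x)) ++ layer (gen x).+1)
    (x :: fset_set (nbrs adj x)).
  by rewrite /layer_sum -!big_cat E big_cons addrAC subrr add0r.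
apply: uniq_perm.
- rewrite !cat_uniq !layer_uniq /= !andbT; apply/andP; split; apply/hasPn => y;
    rewrite ?mem_cat !mem_layer /gen; move: (tag x) (tag y) => p q; lia.
- rewrite /= fset_uniq andbT in_fset_set // notin_setE.
  by rewrite /nbrs /= /at_adj eqxx.
have nbrsE y : (y \in nbrs adj x) = at_adj id x y.
  by apply/idP/idP; rewrite inE.
move=> y; rewrite inE !mem_cat !mem_layer in_fset_set // nbrsE /at_adj.
rewrite [x == y]eq_sym; case: (eqVneq y x) => [->|_]; rewrite /gen /=;
  [move: (tag x) => p | move: (tag x) (tag y) => p q]; lia.
Qed.

Lemma layer_sum_const c m : layer_sum (fun=> c) m = c * m%:R.
Proof.
by rewrite /layer_sum big_const_seq count_predT iter_addr_0 size_layer mulr_natr.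
Qed.

Lemma eq_layer_sum g g' m : {in layer m, g =1 g'} -> layer_sum g m = layer_sum g' m.
Proof. by move=> e; apply: eq_big_seq. Qed.

Lemma layer_sum_ge0 g m : (forall y, 0 <= g y) -> 0 <= layer_sum g m.
Proof. by move=> g0; apply: sumr_ge0. Qed.

Lemma deg_antitree x : (deg adj x)%:R = 3 * (gen x)%:R - 1 :> R.
Proof.
rewrite (degE R (@finite_at_nbrs id)) nbr_sum_layers !layer_sum_const.
by rewrite /gen -!natr1; ring.
Qed.

Lemma sum_sqr_le (T : eqType) (s : seq T) (h : T -> R) :
  (\sum_(i <- s) h i) ^+ 2 <= (size s)%:R * \sum_(i <- s) h i ^+ 2.
Proof.
set n : R := (size s)%:R; set S := \sum_(i <- s) h i.
set P := \sum_(i <- s) h i ^+ 2.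
have [/size0nil s0|s_gt0] := posnP (size s).
  by rewrite /S /P s0 !big_nil expr0n mulr0.
have n0 : 0 < n by rewrite ltr0n.
rewrite -subr_ge0 -(pmulr_rge0 _ n0).
have <- : \sum_(i <- s) (n * h i - S) ^+ 2 = n * (n * P - S ^+ 2).
  rewrite (eq_bigr (fun i => n ^+ 2 * h i ^+ 2 + (- (2 * n * S) * h i + S ^+ 2)));
    last by move=> i _; ring.
  rewrite !big_split /= big_const_seq count_predT iter_addr_0.
  rewrite -[S ^+ 2 *+ _]mulr_natr -!mulr_sumr -/S -/P -/n.
  by ring.
by apply: sumr_ge0 => i _; exact: sqr_ge0.
Qed.

Lemma layer_sum_sqr_le h m :
  layer_sum h m ^+ 2 <= m%:R * layer_sum (fun y => h y ^+ 2) m.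
Proof. by have := sum_sqr_le (layer m) h; rewrite size_layer. Qed.

(** The vertex x contributes to neither sum, whence the factor k - 1. *)
Lemma layer_sum_sqr_le0 h x : h x = 0 ->
  layer_sum h (gen x) ^+ 2
  <= ((gen x)%:R - 1) * layer_sum (fun y => h y ^+ 2) (gen x).
Proof.
move=> hx; have xl : x \in layer (gen x) by rewrite mem_layer.
have := sum_sqr_le (rem x (layer (gen x))) h.
rewrite size_rem // size_layer /layer_sum !(perm_big _ (perm_to_rem xl)) !big_cons.
by rewrite hx expr0n /= !add0r -[(gen x)%:R]natr1 addrK.
Qed.

(** Every sum over neighbours splits into three layer sums minus the value at the
    centre.  The inner summand vanishes at z = y.  The outer one at y = x is
    P_(k-1) + P_k + P_(k+1) over mu(x), because h(x) = 0; together with the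
    degree 3k - 1 it accounts for the factor 3k in [curv_form].  Layer 0 is
    empty, which makes the truncation of n.-1 harmless. *)
Lemma curv_sum_layers (mu : V -> R) (om : nat -> R) h x n :
  (forall y, (mu y)^-1 = om (gen y)) -> h x = 0 -> gen x = n.+1 ->
  let P := layer_sum (fun y => h y ^+ 2) in let S := layer_sum h in
  curv_sum adj mu h x =
  curv_form n.+1%:R (om n) (om n.+1) (om n.+2)
     (P n.-1) (P n) (P n.+1) (P n.+2) (P n.+3)
     (S n.-1) (S n) (S n.+1) (S n.+2) (S n.+3).
Proof.
move=> muE hx gx P S; rewrite /curv_sum.
pose F y := (mu y)^-1 *
  nbr_sum adj (fun z => h z ^+ 2 - 4 * h y * h z + 3 * h y ^+ 2) y.
have inner m y : gen y = m.+1 -> F y = om m.+1 * (P m + P m.+1 + P m.+2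
    - 4 * (S m + S m.+1 + S m.+2) * h y + 9 * m.+1%:R * h y ^+ 2).
  move=> gy; rewrite /F muE gy; congr (_ * _).
  have lay k : layer_sum (fun z => h z ^+ 2 - 4 * h y * h z + 3 * h y ^+ 2) k
             = P k - 4 * h y * S k + 3 * h y ^+ 2 * k%:R.
    rewrite /P /S -layer_sum_const /layer_sum !mulr_sumr.
    by rewrite -sumrB -big_split.
  by rewrite nbr_sum_layers gy !lay -!natr1; ring.
have FE m : layer_sum F m = om m * (m%:R * (P m.-1 + P m + P m.+1)
    - 4 * S m * (S m.-1 + S m + S m.+1) + 9 * m%:R * P m).
  case: m => [|m].
    by rewrite /P /S /layer_sum !big_nil; ring.
  rewrite (@eq_layer_sum _ (fun y => om m.+1 * (P m + P m.+1 + P m.+2)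
     + (om m.+1 * (- 4 * (S m + S m.+1 + S m.+2)) * h y
     + om m.+1 * (9 * m.+1%:R) * h y ^+ 2))); last first.
    by move=> y; rewrite mem_layer => /eqP /inner ->; ring.
  rewrite {1}/layer_sum !big_split /= -!mulr_sumr -/(layer_sum _ _).
  rewrite layer_sum_const -[\sum_(i <- _) h i]/(S _).
  by rewrite -[\sum_(i <- _) h i ^+ 2]/(P _); ring.
rewrite -/F !nbr_sum_layers gx !FE !layer_sum_const (inner n) // muE gx hx.
rewrite -/P -/S /curv_form -!natr1 /=.
by case: n {gx} => [|n]; rewrite /= -?natr1; ring.
Qed.
End Layers.

(** * Curvature of the antitree *)

Section Curvature.
Variable R : realType.
Notation V := (antitree id).
Notation adj := (at_adj id).

Definition deg_weight (m : nat) : R := (3 * m%:R - 1)^-1.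

Lemma natrS_deg_weight (n : nat) (t := n%:R : R) :
  [/\ deg_weight n.+1 = (3 * t + 2)^-1, deg_weight n.+2 = (3 * t + 5)^-1 &
      deg_weight n.+3 = (3 * t + 8)^-1].
Proof. by split; rewrite /deg_weight -!natr1 -/t; congr (_^-1); ring. Qed.

Lemma natr_shift (n : nat) (t := n%:R : R) :
  [/\ n.+1%:R = t + 1, n.+2%:R = t + 2, n.+3%:R = t + 3 & n.+4%:R = t + 4].
Proof. by split; rewrite -!natr1 -/t; ring. Qed.

(** The constant e depends on the generation only, not on the vertex. *)
Lemma layer_form_coercive (om : nat -> R) n :
  om = (fun=> 1) \/ om = deg_weight ->
  exists2 e : R, 0 < e & forall (h : V -> R) x
      (P := layer_sum (fun y => h y ^+ 2)) (S := layer_sum h),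
    gen x = n.+1 -> h x = 0 ->
    e * (P n + P n.+1 + P n.+2) <=
    curv_form n.+1%:R (om n) (om n.+1) (om n.+2)
      (P n.-1) (P n) (P n.+1) (P n.+2) (P n.+3)
      (S n.-1) (S n) (S n.+1) (S n.+2) (S n.+3).
Proof.
move=> omE.
have P0 (h : V -> R) m : 0 <= layer_sum (fun y => h y ^+ 2) m.
  by apply: layer_sum_ge0 => y; exact: sqr_ge0.
case: n => [|n].
  have [w10 w12] : 0 < om 1%N /\ om 1%N <= 5 * om 2%N.
    case: omE => ->; first lra.
    have [-> -> _] := natrS_deg_weight 0; rewrite mulr0 !add0r; lra.
  exists (2 * om 1%N); first by rewrite mulr_gt0.
  move=> h x P S gx hx.
  have S1 : S 1%N = 0.
    apply/eqP; rewrite -sqrf_eq0 eq_le sqr_ge0 andbT.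
    by have := layer_sum_sqr_le0 hx; rewrite gx subrr mul0r.
  have -> : P 0%N = 0 by rewrite /P /layer_sum big_nil.
  have -> : S 0%N = 0 by rewrite /S /layer_sum big_nil.
  rewrite S1 add0r; apply: curv_form_coercive_root => //; try exact: P0.
    exact: layer_sum_sqr_le.
  exact: layer_sum_sqr_le.
pose t : R := n%:R; have t0 : 0 <= t by rewrite ler0n.
have [E1 E2 E3 E4] := natr_shift n.
have [e e0 H] : coercive_curv_form t (om n.+1) (om n.+2) (om n.+3).
  case: omE => ->; first exact: curv_form_coercive_const.
  have [-> -> ->] := natrS_deg_weight n; exact: curv_form_coercive_deg.
exists e => // h x P S gx hx; rewrite E2; apply: H; try exact: P0.
- exact: layer_sum_sqr_le.
- by rewrite /t -E1; exact: layer_sum_sqr_le.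
- have := layer_sum_sqr_le0 hx; rewrite gx E2.
  by rewrite (_ : t + 2 - 1 = t + 1) //; ring.
- by rewrite /t -E3; exact: layer_sum_sqr_le.
- by rewrite /t -E4; exact: layer_sum_sqr_le.
Qed.

(** Test the curvature condition on the generation itself: mu Gamma grows
    linearly in k while mu Gamma_2 stays bounded. *)
Lemma CD_le_inv_generation (mu : V -> R) (om : nat -> R) (K : R) x n :
  om = (fun=> 1) \/ om = deg_weight ->
  (forall y, 0 < mu y) -> (forall y, (mu y)^-1 = om (gen y)) ->
  gen x = n.+2 -> CD_infty adj mu K x -> K <= n.+2%:R^-1.
Proof.
move=> omE mu0 muE gx /(CD_inftyP (@finite_at_nbrs id) mu0).
pose h (y : V) : R := (gen y)%:R - n.+2%:R.
pose t : R := n%:R; have t0 : 0 <= t by rewrite ler0n.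
have [E1 E2 E3 E4] := natr_shift n.
have hx : h x = 0 by rewrite /h gx subrr.
move=> /(_ h hx).
rewrite (curv_sum_layers muE hx gx) nbr_sum_layers gx hx expr0n subr0 /=.
have SE m : layer_sum h m = (m%:R - n.+2%:R) * m%:R.
  rewrite -layer_sum_const; apply: eq_layer_sum => y.
  by rewrite mem_layer /h => /eqP ->.
have PE m : layer_sum (fun y => h y ^+ 2) m = (m%:R - n.+2%:R) ^+ 2 * m%:R.
  rewrite -layer_sum_const; apply: eq_layer_sum => y.
  by rewrite mem_layer /h => /eqP ->.
rewrite !SE !PE E1 E2 E3 E4 -/t -/(generation_form _ _ _ _) => H.
have {}H : 2 * K * ((t + 1 - (t + 2)) ^+ 2 * (t + 1)
    + (t + 2 - (t + 2)) ^+ 2 * (t + 2) + (t + 3 - (t + 2)) ^+ 2 * (t + 3)) <= 4.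
  apply: (le_trans H); case: omE => ->; first by rewrite generation_form_const.
  by have [-> -> ->] := natrS_deg_weight n; exact: generation_form_deg.
have t2 : 0 < t + 2 by rewrite ltr_wpDl.
rewrite -div1r ler_pdivlMr //; clear - H; lra.
Qed.
End Curvature.

Unset Implicit Arguments.

Theorem theorem1p4 (R : realType) (mu : antitree id -> R)
    (hmu : (forall x, mu x = 1) \/ (forall x, mu x = (deg (at_adj id) x)%:R)) :
  let admissible (K : antitree id -> R) :=
    [/\ forall x, 0 < K x,
        forall x y, gen x = gen y -> K x = K y &
        forall x, CD_infty (at_adj id) mu (K x) x] in
  (exists K, admissible K) /\
  (forall K, admissible K ->
     limn_einf (fun k : nat =>
       ereal_inf [set (K x)%:E | x in [set x | gen x = k]]) = 0%E).
Proof.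
move=> admissible.
have [om omE muE] : exists2 om : nat -> R,
    om = (fun=> 1) \/ om = deg_weight R & forall y, (mu y)^-1 = om (gen y).
  case: hmu => muE; first by exists (fun=> 1); [left | move=> y; rewrite muE invr1].
  exists (deg_weight R); first by right.
  by move=> y; rewrite muE deg_antitree.
have mu0 y : 0 < mu y.
  case: hmu => ->; first exact: ltr01.
  rewrite deg_antitree; have : 1 <= (gen y)%:R :> R by rewrite ler1n.
  by lra.
split.
  have [e He] : {e : nat -> R & forall n, 0 < e n /\ _} :=
    choice (fun n => let: ex_intro2 e e0 He := layer_form_coercive n omE in
                     ex_intro _ e (conj e0 He)).
  exists (fun x => e (tag x) / 2); split.
  - by move=> x; rewrite divr_gt0 //; case: (He (tag x)).
  - by move=> x y [->].
  move=> x; apply/(CD_inftyP (@finite_at_nbrs id) mu0) => h hx.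
  have gx : gen x = (tag x).+1 by [].
  have [_ /(_ h x gx hx)] := He (tag x).
  rewrite (curv_sum_layers muE hx gx) nbr_sum_layers gx hx expr0n subr0 /=.
  by rewrite mulrCA divff ?mulr1.
move=> K [K0 Kgen KCD].
(* By the dependence on the generation only, the infimum over generation n.+1
   is the value at any chosen vertex v n. *)
pose v n : antitree id := Tagged (fun i => 'I_i.+1) (ord0 : 'I_n.+1).
have infE n : ereal_inf [set (K x)%:E | x in [set x | gen x = n.+1]]
              = (K (v n))%:E.
  rewrite (_ : [set _ | _ in _] = [set (K (v n))%:E]) ?ereal_inf1 //.
  apply/seteqP; split=> [_ [x gx <-]|_ ->] /=; last by exists (v n).
  by rewrite (Kgen x (v n)) // gx.
suff /cvg_limn_einf_sup[-> //] :
  (fun k => ereal_inf [set (K x)%:E | x in [set x | gen x = k]]) @ \oo --> 0%E.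
rewrite -(cvg_shiftn 2).
have hc : (@harmonic R n)%:E @[n --> \oo] --> 0%:E.
  by apply: cvg_EFin; [near=> n | exact: cvg_harmonic].
apply: (squeeze_cvge _ (cvg_cst _) hc); near=> n.
rewrite /= addn2 infE !lee_fin ltW //=.
have /(CD_le_inv_generation omE mu0 muE _) := KCD (v n.+1).
move=> /(_ n erefl) /le_trans; apply.
by rewrite lef_pV2 ?posrE ?ltr0n // ler_nat.
Unshelve. all: by end_near.
Qed.
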